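(* Let $X$ be a finite set and let $\varnothing\neq Z\subseteq Y\subseteq X$ with $|X|=n$, $|Y|=m$ and $|Z|=k$. Then $$|\mathrm{E}(\mathcal{T}(X,Y,Z))|=\sum_{r=1}^{n-m+k}\ \sum_{i=\max\{1,\,m-n+r\}}^{\min\{k,\,r\}}\binom{k}{i}\binom{n-m}{r-i}\,i^{m-i}\,r^{n-m-r+i}.$$
   Context: $\mathcal{T}(X)$ is the full transformation semigroup on $X$ (all maps $X\to X$ under composition). Maps are written on the right, so $x(\alpha\beta)=(x\alpha)\beta$, and $A\alpha=\{a\alpha : a\in A\}$ for $A\subseteq X$. For $\varnothing\neq Z\subseteq Y\subseteq X$, $\mathcal{T}(X,Y,Z)=\{\alpha\in\mathcal{T}(X): Y\alpha\subseteq Z\}$, a subsemigroup of $\mathcal{T}(X)$. For a semigroup $S$, $\mathrm{E}(S)=\{x\in S: x^2=x\}$ is the set of idempotents of $S$. In the formula, $m-n+r$ is an integer (possibly negative), and the convention $x^0=1$ is used. *)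

(* Defs.v *)
From HB Require Import structures.
From mathcomp Require Import all_boot.

Set Implicit Arguments.
Unset Strict Implicit.
Unset Printing Implicit Defensive.

Local Open Scope group_scope.

#[short(type="finSemigroupType")]
HB.structure Definition FinSemigroup := {S of Semigroup S & Finite S}.

(* The alias keeps the composition product apart from any product that
   {ffun X -> X} might inherit pointwise from X. *)
Definition transf (X : finType) := {ffun X -> X}.

HB.instance Definition _ (X : finType) := Finite.on (transf X).

(* Maps act on the right: x (a b) = (x a) b. *)
Definition transf_mul (X : finType) (a b : transf X) : transf X :=
  [ffun x => b (a x)].

Lemma transf_mulA (X : finType) : associative (@transf_mul X).
Proof. by move=> a b c; apply/ffunP => x; rewrite !ffunE. Qed.

HB.instance Definition _ (X : finType) :=
  isSemigroup.Build (transf X) (@transf_mulA X).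

Definition transfYZ (X : finType) (Y Z : {set X}) : {set transf X} :=
  [set a : transf X | a @: Y \subset Z].

Lemma transfYZ_mul_closed (X : finType) (Y Z : {set X}) :
  Z \subset Y -> {in transfYZ Y Z &, forall a b, a * b \in transfYZ Y Z}.
Proof.
move=> sZY a b; rewrite !inE => /subsetP sa /subsetP sb.
apply/subsetP => _ /imsetP[y yY ->]; rewrite ffunE.
by apply/sb/imset_f/(subsetP sZY)/sa/imset_f.
Qed.

Definition idempotents (S : finSemigroupType) (A : {set S}) : {set S} :=
  [set x in A | x * x == x].

(* Main.v *)
(* An idempotent e is determined by its set A of fixed points, which is also
   its image, together with an arbitrary map from the complement of A to A.
   Membership in T(X,Y,Z) means that A is a subset of Z together with the
   complement of Y, and that Y is mapped into A :&: Z; with #|A| = r and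
   #|A :&: Z| = i this leaves i choices at each of the m - i points of
   Y :\: A and r choices at each of the remaining n - m - (r - i) points
   outside A.  The formula follows by summing over A. *)
Require Import Defs.
From mathcomp Require Import all_boot zify.

(** After exchanging the sums, each [x] contributes only at [j = f x], which the bound places in the
    range. This produces both the sum over [r] and the sum over [i]. *)
Lemma partition_big_interval (I : finType) (P : pred I) (f : I -> nat)
    (a b : nat) (F : I -> nat) :
    (forall x, P x -> a <= f x < b) ->
  \sum_(x | P x) F x = \sum_(a <= j < b) \sum_(x | P x && (f x == j)) F x.
Proof.
move=> fab; rewrite -(exchange_big_dep xpredT) //=.
apply: eq_bigr => x Px.
by under eq_bigl do rewrite eq_sym; rewrite big_nat1_eq fab.
Qed.

(** [A] corresponds to the pair [(A :&: B, A :&: C)], with union as inverse; disjointness makes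
    every pair occur. *)
Lemma card_subsets_setU_disjoint (T : finType) (B C : {set T}) (i j : nat) :
    [disjoint B & C] ->
  #|[set A : {set T} | [&& A \subset B :|: C, #|A :&: B| == i
                         & #|A :&: C| == j]]| = 'C(#|B|, i) * 'C(#|C|, j).
Proof.
move=> disBC; have BC0 : B :&: C = set0 by apply/eqP; rewrite setI_eq0.
rewrite -!cards_draws -cardsX.
set D := [set A | _].
pose f (A : {set T}) := (A :&: B, A :&: C).
have f_inj : {in D &, injective f}.
  move=> A1 A2; rewrite !inE => /and3P[s1 _ _] /and3P[s2 _ _] [e1 e2].
  by rewrite -(setIidPl s1) -(setIidPl s2) !setIUr e1 e2.
rewrite -(card_in_imset f_inj); apply: eq_card => -[A1 A2].
rewrite !inE; apply/imsetP/andP => [[A] | /= [/andP[s1 c1] /andP[s2 c2]]].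
  by rewrite inE => /and3P[_ c1 c2] [-> ->]; rewrite !subsetIr.
have eB : (A1 :|: A2) :&: B = A1.
  rewrite setIUl (setIidPl s1); apply/setUidPl/subsetP => x; rewrite inE.
  by case/andP=> /(subsetP s2) xC xB; have := in_set0 x; rewrite -BC0 inE xB xC.
have eC : (A1 :|: A2) :&: C = A2.
  rewrite setIUl (setIidPl s2); apply/setUidPr/subsetP => x; rewrite inE.
  by case/andP=> /(subsetP s1) xB xC; have := in_set0 x; rewrite -BC0 inE xB xC.
by exists (A1 :|: A2); rewrite /f ?inE eB eC // c1 c2 setUSS.
Qed.

Section FixedPoints.

Variables (X : finType) (Y Z : {set X}).

Definition fixed_points (e : transf X) : {set X} := [set x | e x == x].

(** Choices are independent from point to point, so the maps can be counted as a product. *)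
Definition allowed_values (A : {set X}) (x : X) : {set X} :=
  if x \in A then [set x] else if x \in Y then A :&: Z else A.

(** An idempotent takes its values in its fixed points, and a fixed point in [Y] is its own image,
    hence in [Z]. Conversely, all allowed values lie in [A], and only [x] itself is allowed at [x]
    in [A], so [e] fixes exactly [A]. *)
Lemma idempotents_fixed_pointsP (A : {set X}) (e : transf X) :
  (e \in idempotents (transfYZ Y Z)) && (fixed_points e == A) =
  (A \subset Z :|: ~: Y) && [forall x, e x \in allowed_values A x].
Proof.
rewrite !inE; apply/idP/idP.
  case/andP=> /andP[/subsetP sYZ /eqP/ffunP ee] /eqP <-.
  have eK x : e (e x) = e x by rewrite -[in RHS]ee ffunE.
  have eZ y : y \in Y -> e y \in Z by move=> yY; apply/sYZ/imset_f.
  apply/andP; split.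
    apply/subsetP => x; rewrite !inE => /eqP ex.
    by case: (boolP (x \in Y)) => [/eZ | _]; rewrite ?orbT // ex => ->.
  apply/forallP => x; rewrite /allowed_values inE.
  case: eqP => [-> | _]; first exact: set11.
  by case: ifP => [/eZ xZ | _]; rewrite !inE eK eqxx.
case/andP=> /subsetP sA /forallP eV.
have eA x : e x \in A.
  move: (eV x); rewrite /allowed_values.
  case: ifP => [xA | _]; first by rewrite inE => /eqP ->.
  by case: ifP => // _; rewrite inE => /andP[].
have eid x : x \in A -> e x = x.
  by move=> xA; move: (eV x); rewrite /allowed_values xA inE => /eqP.
apply/andP; split; first (apply/andP; split).
- apply/subsetP => _ /imsetP[y yY ->].
  move: (eV y); rewrite /allowed_values yY.
  case: ifP => [yA | _]; last by rewrite inE => /andP[].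
  by rewrite inE => /eqP ->; move: (sA y yA); rewrite !inE yY orbF.
- by apply/eqP/ffunP => x; rewrite ffunE eid.
apply/eqP/setP => x; rewrite inE.
by apply/eqP/idP => [<- // | /eid].
Qed.

Lemma card_allowed_maps (A : {set X}) : Z \subset Y -> A \subset Z :|: ~: Y ->
  #|[pred e : transf X | [forall x, e x \in allowed_values A x]]| =
  #|A :&: Z| ^ (#|Y| - #|A :&: Z|)
    * #|A| ^ ((#|X| + #|A :&: Z|) - (#|Y| + #|A|)).
Proof.
move=> sZY /subsetP sA.
have AY : A :&: Y = A :&: Z.
  apply/setP => x; rewrite !inE; apply: andb_id2l => /sA; rewrite !inE.
  by case: (boolP (x \in Z)) => [/(subsetP sZY) -> | _ /= /negbTE].
transitivity (\prod_(x in X) #|allowed_values A x|).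
  by rewrite (card_family (fun x => mem (allowed_values A x))) foldrE
       big_image_cond.
rewrite (bigID (mem A)) /= big1 ?mul1n; last first.
  by move=> x xA; rewrite /allowed_values xA cards1.
rewrite (bigID (mem Y)) /=; congr (_ * _).
  rewrite (eq_bigl (mem (Y :\: A))) => [|x]; last by rewrite !inE.
  rewrite (eq_bigr (fun _ => #|A :&: Z|)) => [|x /setDP[xY xA]].
    by rewrite prod_nat_const cardsD (setIC Y) AY.
  by rewrite /allowed_values (negbTE xA) xY.
rewrite (eq_bigl (mem (~: (Y :|: A)))) => [|x]; last first.
  by rewrite !inE negb_or andbC.
rewrite (eq_bigr (fun _ => #|A|)) => [|x]; last first.
  rewrite !inE negb_or => /andP[xY xA].
  by rewrite /allowed_values (negbTE xA) (negbTE xY).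
rewrite prod_nat_const; congr (_ ^ _).
(* Inclusion-exclusion for [Y] and [A]; a single final subtraction in the exponent avoids
   intermediate truncation. *)
rewrite -AY; have := cardsC (Y :|: A); have := cardsUI Y A.
by rewrite (setIC Y) => eUI <-; rewrite addnAC eUI addKn.
Qed.

End FixedPoints.

Theorem theorem4p7 (X : finType) (Y Z : {set X}) (n m k : nat)
    (Z_neq0 : Z != set0) (sZY : Z \subset Y)
    (card_X : #|X| = n) (card_Y : #|Y| = m) (card_Z : #|Z| = k) :
  #|idempotents (transfYZ Y Z)| =
    \sum_(1 <= r < (n - m + k).+1)
      \sum_(maxn 1 (m + r - n) <= i < (minn k r).+1)
        'C(k, i) * 'C(n - m, r - i) * i ^ (m - i) * r ^ ((n + i) - (m + r)).
Proof.
have disZY : [disjoint Z & ~: Y] by rewrite disjoints_subset setCK.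
have card_CY : #|~: Y| = n - m by have := cardsC Y; lia.
have le_km : k <= m by rewrite -card_Z -card_Y subset_leq_card.
have le_mn : m <= n by rewrite -card_X -card_Y max_card.
have k_gt0 : 0 < k by rewrite -card_Z card_gt0.
have cardA (A : {set X}) : A \subset Z :|: ~: Y ->
    #|A| = #|A :&: Z| + #|A :&: ~: Y|.
  move=> sA; rewrite -[in LHS](setIidPl sA) setIUr cardsU.
  rewrite setIACA (eqP (_ : Z :&: ~: Y == set0)) ?setI_eq0 //.
  by rewrite setI0 cards0 subn0.
pose g i r := i ^ (m - i) * r ^ ((n + i) - (m + r)).
transitivity (\sum_(A : {set X} | (A \subset Z :|: ~: Y) && (0 < #|A :&: Z|))
                g #|A :&: Z| #|A|).
  rewrite -sum1_card (partition_big (@fixed_points X) predT) //=.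
  rewrite big_mkcond [RHS]big_mkcond; apply: eq_bigr => A _ /=.
  under eq_bigl do rewrite idempotents_fixed_pointsP.
  case: (boolP (A \subset _)) => sA /=; last by rewrite big_pred0.
  rewrite sum1_card card_allowed_maps // card_X card_Y.
  (* If [A] misses [Z], the factor [0 ^ m] vanishes, since [m >= k > 0]. *)
  case: posnP => [-> | //].
  by rewrite subn0 exp0n //; lia.
(* [A] meets [Z] and has at most [k] points in [Z] and [n - m] outside [Y]. *)
rewrite (partition_big_interval _ _ (fun A : {set X} => #|A|)
           1 (n - m + k).+1) => [|A /andP[sA A_gt0]]; last first.
  rewrite (cardA A sA); have := subset_leq_card (subsetIr A Z).
  by have := subset_leq_card (subsetIr A (~: Y)); lia.
apply: eq_bigr => r _.
(* The lower bound comes from [r - i <= n - m]. When [m + r < n] the truncated difference is 0, and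
   the maximum with 1 absorbs it. *)
rewrite (partition_big_interval _ _ (fun A : {set X} => #|A :&: Z|)
           (maxn 1 (m + r - n)) (minn k r).+1) => [|A]; last first.
  case/andP=> /andP[sA A_gt0] /eqP Ar.
  have := cardA A sA; have := subset_leq_card (subsetIr A Z).
  by have := subset_leq_card (subsetIr A (~: Y)); lia.
apply: eq_big_nat => i /andP[i_ge i_lt].
rewrite (eq_bigr (fun _ => g i r)) => [|A]; last first.
  by case/andP=> /andP[_ /eqP ->] /eqP ->.
rewrite sum_nat_const -mulnA; congr (_ * _).
rewrite -card_Z -card_CY -card_subsets_setU_disjoint // cardsE.
(* Since [1 <= i <= r], having [i] points in [Z] and [r] in all amounts to having [i] in [Z] and
   [r - i] outside [Y]. *)
apply: eq_card => A; rewrite !unfold_in.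
case: (boolP (A \subset _)) => //= /cardA ->.
by lia.
Qed.
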